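(* The set of all $T\in M(\mathcal{C})$ such that the minimal Cantor system $(\mathcal{C},T)$ is conjugate to a rank-$1$ subshift is dense but not generic in the space $M(\mathcal{C})$ of all minimal Cantor systems.
   Context: $\mathcal{C}=\{0,1\}^{\mathbb{N}}$ has the product topology and metric $d_{\mathcal{C}}(x,y)=2^{-n}$ for $x\neq y$, where $n$ is least with $x(n)\ne y(n)$. $\mathrm{Aut}(\mathcal{C})$ is the Polish space of all homeomorphisms of $\mathcal{C}$ with the topology given by $d(T,S)=\sup_{x\in\mathcal{C}}d_{\mathcal{C}}(Tx,Sx)$. $M(\mathcal{C})$ is the subspace of minimal homeomorphisms (every orbit is dense); it is $G_\delta$ in $\mathrm{Aut}(\mathcal{C})$, hence Polish, and is the coding space of all minimal Cantor systems. A subset of a Polish space is generic if it contains a dense $G_\delta$ subset. Systems $(X,T)$ and $(Y,S)$ are conjugate if there is a homeomorphism $\varphi:X\to Y$ with $\varphi T=S\varphi$. Rank-$1$ subshifts: Given integers $r_n>1$ ($n\ge0$) and nonnegative integers $s_{n,i}$ ($n\ge0$, $1\le i<r_n$), define finite $0,1$-words $v_0=0$ and $v_{n+1}=v_n1^{s_{n,1}}v_n\cdots v_n1^{s_{n,r_n-1}}v_n$ (with $r_n$ copies of $v_n$). The infinite word $V=\lim_nv_n$ is a rank-$1$ word, and $X_V=\{x\in\{0,1\}^{\mathbb{Z}}:$ every finite subword of $x$ is a subword of $V\}$, with the shift $\sigma(x)(n)=x(n+1)$, is a rank-$1$ subshift. *)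

(* Defs.v *)
From HB Require Import structures.
From mathcomp Require Import all_boot all_order all_algebra.
From mathcomp Require Import all_classical all_reals all_analysis.
From mathcomp Require Import borel_hierarchy.

Set Implicit Arguments.
Unset Strict Implicit.
Unset Printing Implicit Defensive.

Import Order.TTheory GRing.Theory Num.Theory.

Local Open Scope classical_set_scope.
Local Open Scope ring_scope.

Definition homeomorphism (X Y : topologicalType) (f : X -> Y) : Prop :=
  exists g : Y -> X, [/\ cancel f g, cancel g f, continuous f & continuous g].

(* For bijective [T] the second disjunct says [y = T^(-n) x], so this is the
   two-sided orbit [{T^k x | k in Z}]. *)
Definition zorbit (X : Type) (T : X -> X) (x : X) : set X :=
  [set y | exists n : nat, iter n T x = y \/ iter n T y = x].

Definition minimal (X : topologicalType) (T : X -> X) : Prop :=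
  forall x : X, dense (zorbit T x).

Definition conjugate (X Y : topologicalType) (T : X -> X) (S : Y -> Y) : Prop :=
  exists phi : X -> Y, homeomorphism phi /\ phi \o T = S \o phi.

Definition generic (X : topologicalType) (A : set X) : Prop :=
  exists G : set X, [/\ Gdelta G, dense G & G `<=` A].

Section cantor_dist.
Variable R : realType.
Implicit Types x y z : cantor_space.

Definition cantor_dist x y : R :=
  if pselect (exists n, x n != y n) is left exy then 2 ^- ex_minn exy else 0.

Lemma cantor_dist_ge0 x y : 0 <= cantor_dist x y.
Proof. by rewrite /cantor_dist; case: pselect => // e; rewrite invr_ge0 exprn_ge0. Qed.

Lemma cantor_dist_le1 x y : cantor_dist x y <= 1.
Proof.
rewrite /cantor_dist; case: pselect => [e|_]; last exact: ler01.
by rewrite invf_le1 ?exprn_gt0// exprn_ege1// ler1n.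
Qed.

Lemma cantor_distxx x : cantor_dist x x = 0.
Proof. by rewrite /cantor_dist; case: pselect => // e; case: (e) => n; case/eqP. Qed.

Lemma cantor_dist0 x y : cantor_dist x y = 0 -> x = y.
Proof.
rewrite /cantor_dist; case: pselect => [e /eqP|e _].
  by rewrite invr_eq0 expf_eq0 pnatr_eq0 andbF.
by apply/funext => n; apply/eqP/negPn/negP => xy; apply: e; exists n.
Qed.

Lemma cantor_dist_ge x y n : x n != y n -> 2 ^- n <= cantor_dist x y.
Proof.
move=> xy; rewrite /cantor_dist; case: pselect => [e|[]]; last by exists n.
case: ex_minnP => m _ /(_ _ xy) mn.
by rewrite lef_pV2 ?posrE ?exprn_gt0// ler_weXn2l// ler1n.
Qed.

Lemma cantor_dist_le x y e : 0 <= e ->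
  (forall n, x n != y n -> 2 ^- n <= e) -> cantor_dist x y <= e.
Proof.
move=> e0 H; rewrite /cantor_dist; case: pselect => // ex.
by case: ex_minnP => m xym _; exact: H.
Qed.

Lemma cantor_dist_sym x y : cantor_dist x y = cantor_dist y x.
Proof.
by apply/eqP; rewrite eq_le; apply/andP; split;
  apply: cantor_dist_le (cantor_dist_ge0 _ _) _ => n xy;
  apply: cantor_dist_ge; rewrite eq_sym.
Qed.

Lemma cantor_dist_triangle y x z :
  cantor_dist x z <= cantor_dist x y + cantor_dist y z.
Proof.
apply: cantor_dist_le => [|n xz]; first by rewrite addr_ge0 ?cantor_dist_ge0.
have [xy|xy] := eqVneq (x n) (y n).
  by rewrite (le_trans (cantor_dist_ge (y := z) (x := y) (n := n) _)) -?xy//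
    lerDr cantor_dist_ge0.
by rewrite (le_trans (cantor_dist_ge xy))// lerDl cantor_dist_ge0.
Qed.

End cantor_dist.

(* [R] only serves to attach an [R]-valued metric to the type. *)
Definition cantor_aut (R : realType) : Type :=
  [set T : cantor_space -> cantor_space | homeomorphism T].

HB.instance Definition _ (R : realType) := Choice.on (cantor_aut R).

Definition aut_fun (R : realType) (T : cantor_aut R) :
  cantor_space -> cantor_space := set_val T.
Coercion aut_fun : cantor_aut >-> Funclass.

Section aut_dist.
Variable R : realType.
Implicit Types S T U : cantor_aut R.

Definition aut_dist T S : R := sup [set cantor_dist R (T x) (S x) | x in setT].

Lemma aut_dist_ge T S x : cantor_dist R (T x) (S x) <= aut_dist T S.
Proof.
apply: ub_le_sup; last by exists x.
by exists 1 => _ [y _ <-]; exact: cantor_dist_le1.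
Qed.

Lemma aut_dist_le T S e :
  (forall x, cantor_dist R (T x) (S x) <= e) -> aut_dist T S <= e.
Proof.
move=> H; apply: ge_sup; last by move=> _ [x _ <-].
by exists (cantor_dist R (T point) (S point)), point.
Qed.

Lemma aut_distxx T : aut_dist T T = 0.
Proof.
apply/eqP; rewrite eq_le; apply/andP; split.
  by apply: aut_dist_le => x; rewrite cantor_distxx.
by rewrite -(cantor_distxx R (T point)) aut_dist_ge.
Qed.

Lemma aut_dist0 T S : aut_dist T S = 0 -> T = S.
Proof.
move=> d0; apply: val_inj; apply/funext => x; apply: (@cantor_dist0 R).
by apply/eqP; rewrite eq_le cantor_dist_ge0 -d0 andbT (aut_dist_ge T S x).
Qed.

Lemma aut_dist_sym T S : aut_dist T S = aut_dist S T.
Proof.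
by congr sup; apply/seteqP; split=> _ [x _ <-]; exists x => //;
  rewrite cantor_dist_sym.
Qed.

Lemma aut_dist_triangle S T U : aut_dist T U <= aut_dist T S + aut_dist S U.
Proof.
apply: aut_dist_le => x; apply: le_trans (cantor_dist_triangle _ (S x) _ _) _.
by apply: lerD; exact: aut_dist_ge.
Qed.

HB.instance Definition _ := isMetric.Build R (cantor_aut R)
  aut_distxx aut_dist0 aut_dist_sym aut_dist_triangle.

End aut_dist.

(* Its coercion to a type carries the subspace topology. *)
Definition minimal_aut (R : realType) : set (cantor_aut R) :=
  [set T | minimal T].
Arguments minimal_aut : clear implicits.

Definition cut_params (r : nat -> nat) : Prop := forall n, (1 < r n)%N.

(* [rank1_word r s n] is [v_n]; only the values [s n i] with [1 <= i < r n]
   are used. *)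
Fixpoint rank1_word (r : nat -> nat) (s : nat -> nat -> nat) (n : nat) :
    seq bool :=
  if n is m.+1 then
    let v := rank1_word r s m in
    v ++ flatten [seq nseq (s m i) true ++ v | i <- iota 1 (r m).-1]
  else [:: false].

(* The limit [V] of the words [v_n]; see [rank1_limitP]. *)
Definition rank1_limit (r : nat -> nat) (s : nat -> nat -> nat) (k : nat) :
  bool := nth false (rank1_word r s k) k.

Section rank1_limit.
Variables (r : nat -> nat) (s : nat -> nat -> nat).

Lemma rank1_word_prefix m n : (m <= n)%N ->
  prefix (rank1_word r s m) (rank1_word r s n).
Proof.
elim: n => [|n IHn]; first by rewrite leqn0 => /eqP->; exact: prefix_refl.
rewrite leq_eqVlt => /predU1P[->|/IHn mn]; first exact: prefix_refl.
exact/(prefix_trans mn)/prefix_prefix.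
Qed.

Lemma size_rank1_word n : cut_params r -> (n < size (rank1_word r s n))%N.
Proof.
move=> r1; elim: n => //= n IHn; have := r1 n; case: (r n) => [|[|k]]//= _.
rewrite !size_cat (leq_ltn_trans IHn)// -[ltnLHS]addn0 ltn_add2l.
by rewrite -addnA addnCA ltn_addr// (leq_ltn_trans _ IHn).
Qed.

Lemma rank1_limitP n : cut_params r ->
  mkseq (rank1_limit r s) (size (rank1_word r s n)) = rank1_word r s n.
Proof.
move=> r1; apply: (@eq_from_nth _ false); rewrite size_mkseq// => i iv.
have prefix_nth (u w : seq bool) j : prefix u w -> (j < size u)%N ->
  nth false u j = nth false w j by move=> /prefixP[t ->] ju; rewrite nth_cat ju.
rewrite nth_mkseq// /rank1_limit; have [ni|/ltnW ni] := leqP i n.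
  exact/prefix_nth/size_rank1_word/r1/rank1_word_prefix.
by apply/esym/prefix_nth => //; exact: rank1_word_prefix.
Qed.

End rank1_limit.

Definition biinfinite : Type := prod_topology (fun _ : int => bool).
HB.instance Definition _ := Topological.on biinfinite.

Definition bishift (x : biinfinite) : biinfinite := fun n : int => x (n + 1).

Definition subword_biinf (w : seq bool) (x : biinfinite) : Prop :=
  exists k : int, w = mkseq (fun i => x (k + i%:Z)) (size w).

Definition subword_inf (w : seq bool) (V : nat -> bool) : Prop :=
  exists k : nat, w = mkseq (fun i => V (k + i)%N) (size w).

Definition subshift_of (V : nat -> bool) : set biinfinite :=
  [set x | forall w, subword_biinf w x -> subword_inf w V].

Lemma shift_subshift_of V x : subshift_of V x -> subshift_of V (bishift x).
Proof.
move=> Vx w [k wE]; apply: Vx; exists (k + 1); rewrite {1}wE.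
by apply: eq_mkseq => i; rewrite /bishift addrAC.
Qed.

Definition subshift_map V (x : subshift_of V) : subshift_of V :=
  exist _ (bishift (set_val x)) (mem_set (shift_subshift_of (set_valP x))).

Definition conjugate_to_rank1 (X : topologicalType) (T : X -> X) : Prop :=
  exists (r : nat -> nat) (s : nat -> nat -> nat), cut_params r /\
    conjugate T (@subshift_map (rank1_limit r s)).

(* Main.v *)
From HB Require Import structures.
Require Import Defs.
From mathcomp Require Import all_boot all_order all_algebra.
From mathcomp Require Import all_classical all_reals all_analysis.
From mathcomp Require Import borel_hierarchy.
From mathcomp Require Import zify.

(** Call a map [p] from the Cantor space onto [0, ..., L - 1] a cyclic coding of
   [S] if it is locally constant and [p (S y) = p y + 1] modulo [L].

   Approximation: given [T] minimal and [N], an orbit segment of [T] of some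
   length [L] visits all the atoms of [x |-> (x|N, (T x)|N)] and returns to the
   atom it started from.  The rank-1 words [v_(n+1) = v_n 1^(L-1) v_n 1^(2L-1) v_n]
   give a minimal Cantor subshift in which the zeros of a point are all congruent
   modulo [L]; reading off this phase projects it onto the cyclic orbit segment.
   By Brouwer's characterization of the Cantor set, applied over each atom, the
   subshift can be transported to the Cantor space so that its phases refine the
   atoms, and then the shift agrees with [T] up to the first [N] coordinates and
   has a cyclic coding finer than these coordinates.  This gives density.

   Non-genericity: by a Baire-type construction a dense G-delta set contains a
   limit [t] of such approximations having cyclic codings of arbitrarily fine
   mesh.  (The codings make the limit a minimal homeomorphism, so completeness
   is not needed.)  But [t] then has distinct points with the same coding by [p]
   along their whole orbits, whereas a subshift is expansive. *)

Set Implicit Arguments.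
Unset Strict Implicit.
Unset Printing Implicit Defensive.

Import Order.TTheory GRing.Theory Num.Theory.

Local Open Scope classical_set_scope.

(** * Topologies read off binary codes *)

Definition agree (k : nat) (x y : nat -> bool) : Prop :=
  forall i, (i < k)%N -> x i = y i.

Lemma agree_refl k x : agree k x x. Proof. by []. Qed.

Lemma agree_sym k x y : agree k x y -> agree k y x.
Proof. by move=> xy i /xy. Qed.

Lemma agree_trans k y x z : agree k x y -> agree k y z -> agree k x z.
Proof. by move=> xy yz i ik; rewrite xy// yz. Qed.

Lemma agree_le k l x y : (k <= l)%N -> agree l x y -> agree k x y.
Proof. by move=> kl xy i ik; apply: xy; exact: leq_trans kl. Qed.

Lemma agree_eq x y : (forall k, agree k x y) -> x = y.
Proof. by move=> xy; apply/funext => i; exact: (xy i.+1). Qed.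

(** The topology is the one pulled back from the Cantor space along [v]. Cantor space, bi-infinite
    sequences, subshifts and metrized subsets are all handled this way, so that topology becomes a
    matter of finite prefixes; injectivity of [v] is assumed separately. *)
Definition coded (X : topologicalType) (v : X -> nat -> bool) : Prop :=
  forall x (U : set X),
    nbhs x U <-> exists k, forall y, agree k (v x) (v y) -> U y.

Lemma near_bool_prod (I : choiceType) (s : seq I)
    (x : prod_topology (fun _ : I => bool)) :
  \forall y \near x, forall i, i \in s -> x i = y i.
Proof.
elim: s => [|i s IHs]; first by near=> y => i; rewrite inE.
near=> y => j; rewrite inE => /predU1P[->|js]; last by rewrite (near IHs y).
near: y; exists (proj i @^-1` [set x i]); split => //.
suff : @open (prod_topology (fun _ : I => bool)) (proj i @^-1` [set x i]) by [].
by apply: open_comp; [move=> + _; exact: proj_continuous|exact: discrete_open].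
Unshelve. all: by end_near. Qed.

Lemma coded_bool_prod (I : choiceType) (W : nat -> seq I)
    (code : prod_topology (fun _ : I => bool) -> nat -> bool) :
  (forall i, exists k, i \in W k) ->
  (forall k x y, agree k (code x) (code y) <-> forall i, i \in W k -> x i = y i) ->
  coded code.
Proof.
move=> Wcov codeE x U; split=> [nU|[k kU]]; last first.
  apply: filterS (near_bool_prod (W k) x) => y xy; apply: kU.
  by apply/codeE.
(* The code cylinders around [x] form a filter converging to [x] in each coordinate, hence in the
   product, whose topology is the supremum of the coordinate topologies. *)
pose F := filter_from [set: nat] (fun k => [set y | agree k (code x) (code y)]).
have FF : Filter F.
  apply: filter_from_filter; first by exists 0%N.
  move=> i j _ _; exists (maxn i j) => // y xy.
  by split; apply: agree_le xy; rewrite ?leq_maxl ?leq_maxr.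
suff : F --> x by move=> /(_ U nU)[k _ kU]; exists k.
apply/cvg_sup => i A /=.
move=> [B [[C oC <-] /= Cx BA]].
have [k ik] := Wcov i; exists k => // y /codeE xy.
by apply: BA; rewrite /= /proj -xy.
Qed.

Lemma coded_cantor : coded (id : cantor_space -> nat -> bool).
Proof.
apply: (@coded_bool_prod nat (iota 0)) => [i|k x y].
  by exists i.+1; rewrite mem_iota ltnS /=.
split=> xy i; first by rewrite mem_iota => /xy.
by move=> ik; apply: xy; rewrite mem_iota.
Qed.

Lemma coded_initial (X : topologicalType) (v : X -> nat -> bool) (A : set X) :
  coded v -> coded (v \o set_val : A -> nat -> bool).
Proof.
move=> cv x U; split=> [[_ [[B oB <-] /= Bx BU]]|[k kU]].
  have /cv[k kB] : nbhs (set_val x) B by exact: open_nbhs_nbhs.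
  by exists k => y xy; apply: BU; exact: kB.
have : nbhs (set_val x) [set y | agree k (v (set_val x)) (v y)].
  by apply/cv; exists k.
move=> /(@initial_continuous A X set_val x) nA.
by apply: (@filterS _ (nbhs x) _ _ _ _ nA) => y xy; exact: (kU y xy).
Qed.

Section coded_theory.
Variables (X : topologicalType) (v : X -> nat -> bool).
Hypothesis cv : coded v.

Lemma coded_agree k x : nbhs x [set y | agree k (v x) (v y)].
Proof. by apply/cv; exists k. Qed.

Lemma coded_openP (U : set X) :
  open U <-> forall x, U x -> exists k, forall y, agree k (v x) (v y) -> U y.
Proof.
rewrite openE; split=> [oU x /oU|oU x /oU kU]; first by rewrite /interior => /cv.
by rewrite /interior; apply/cv.
Qed.

Lemma coded_continuousP (Y : topologicalType) (w : Y -> nat -> bool)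
    (f : X -> Y) : coded w ->
  continuous f <-> forall x n, exists m, forall y,
    agree m (v x) (v y) -> agree n (w (f x)) (w (f y)).
Proof.
move=> cw; split=> [cf x n|cf x U /cw[n nU]].
  suff /cv[m ] : nbhs x (f @^-1` [set y | agree n (w (f x)) (w y)]) by exists m.
  by apply: cf; apply/cw; exists n.
by have [m mU] := cf x n; apply/cv; exists m => y /mU /nU.
Qed.

Lemma coded_hausdorff : injective v -> hausdorff_space X.
Proof.
move=> vI x y xy; apply: vI; apply: agree_eq => k.
have [z [/= xz yz]] := xy _ _ (coded_agree k x) (coded_agree k y).
exact: agree_trans xz (agree_sym yz).
Qed.

Lemma coded_zero_dimensional : injective v -> zero_dimensional X.
Proof.
move=> vI x y xy.
have [i xyi] : exists i, v x i != v y i.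
  apply: contrapT => xyE; move/eqP: xy; apply; apply: vI; apply/funext => i.
  by apply/eqP; apply: contrapT => /negP ?; apply: xyE; exists i.
have opb b : open [set z | v z i = b].
  by apply/coded_openP => z /= zb; exists i.+1 => z' <-.
exists [set z | v z i = v x i]; split => //; last by move=> /= E; rewrite E eqxx in xyi.
split; first exact: opb.
rewrite -openC; have -> : ~` [set z | v z i = v x i] = [set z | v z i = ~~ v x i].
  by apply/seteqP; split=> z /=; case: (v z i); case: (v x i).
exact: opb.
Qed.

Lemma coded_compact : closed (range v : set cantor_space) ->
  compact [set: X].
Proof.
move=> vcl F PF _.
(* A cluster point of the image filter lies in the closed range of [v], and any preimage of it is a
   cluster point of [F]. *)
have [z [_ zF]] := @cantor_space_compact (v @ F) _ filterT.
have [x _ xz] : range v z.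
  have /closure_id -> := vcl.
  move: zF; rewrite clusterE; apply.
  by apply: (@filterS _ F _ setT) filterT => y _; exists y.
exists x; split=> // A U FA /cv[k kU].
have [] := zF (v @` A) [set y | agree k z y].
- by apply: (@filterS _ F _ A) FA => y Ay; exists y.
- by apply/coded_cantor; exists k.
by move=> _ /= [[y Ay <-] zy]; exists y; split=> //; apply: kU; rewrite xz.
Qed.

End coded_theory.

Lemma compact_homeomorphism (X Y : topologicalType) (f : X -> Y) :
  compact [set: X] -> hausdorff_space Y -> continuous f -> bijective f ->
  homeomorphism f.
Proof.
move=> cX hY cf [g fK gK]; exists g; split=> //.
apply/continuous_closedP => A clA.
have -> : g @^-1` A = f @` A.
  by apply/seteqP; split=> [y Ay|_ [x Ax <-]]; [exists (g y)|rewrite /= fK].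
apply: compact_closed => //; apply: continuous_compact.
  exact: continuous_subspaceT.
exact: subclosed_compact cX _.
Qed.

(** * Closed perfect subsets of the Cantor space *)

(* Retopologized by [cantor_dist] because [homeomorphism_cantor_like] only
   applies to pointed pseudometric types. *)
Definition metric_sub (R : realType) (K : set cantor_space) (x0 : K) : Type :=
  K.

Section metric_sub.
Variables (R : realType) (K : set cantor_space) (x0 : K).
Local Notation S := (metric_sub R x0).

HB.instance Definition _ := Choice.on S.

Definition metric_sub_val (x : S) : cantor_space := set_val (x : K).

Definition metric_sub_dist (x y : S) : R :=
  cantor_dist R (metric_sub_val x) (metric_sub_val y).

Lemma metric_sub_distxx x : metric_sub_dist x x = 0%R.
Proof. exact: cantor_distxx. Qed.

Lemma metric_sub_dist0 x y : metric_sub_dist x y = 0%R -> x = y.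
Proof. by move=> /cantor_dist0/val_inj. Qed.

Lemma metric_sub_dist_sym x y : metric_sub_dist x y = metric_sub_dist y x.
Proof. exact: cantor_dist_sym. Qed.

Lemma metric_sub_dist_triangle x y z :
  (metric_sub_dist y z <= metric_sub_dist y x + metric_sub_dist x z)%R.
Proof. exact: cantor_dist_triangle. Qed.

HB.instance Definition _ := isMetric.Build R S
  metric_sub_distxx metric_sub_dist0 metric_sub_dist_sym metric_sub_dist_triangle.
HB.instance Definition _ := isPointed.Build S x0.

End metric_sub.

(** Off by one: a first difference at index [k] gives distance exactly [2 ^- k], so the strict
    inequality also forces agreement at [k]. *)
Lemma agree_cantor_dist (R : realType) k (x y : cantor_space) :
  (cantor_dist R x y < 2 ^- k)%R <-> agree k.+1 x y.
Proof.
split=> [xyk i ik|xy].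
  apply/eqP/negP => /negP xyi; move: xyk; apply/negP; rewrite -leNgt.
  apply: le_trans (cantor_dist_ge R xyi).
  by rewrite lef_pV2 ?posrE ?exprn_gt0// ler_weXn2l// ler1n.
apply: (@le_lt_trans _ _ (2 ^- k.+1)%R).
  apply: cantor_dist_le => [|n xyn]; first by rewrite invr_ge0 exprn_ge0.
  rewrite lef_pV2 ?posrE ?exprn_gt0// ler_weXn2l// ?ler1n//.
  by rewrite leqNgt; apply/negP => nk; rewrite xy ?eqxx// in xyn.
by rewrite ltf_pV2 ?posrE ?exprn_gt0// ltr_eXn2l// ltr1n.
Qed.

Lemma cantor_dist_small (R : realType) (e : R) : (0 < e)%R ->
  exists k, forall x y, agree k x y -> (cantor_dist R x y < e)%R.
Proof.
move=> e0; have [k _ ke] := near_infty_natSinv_expn_lt (PosNum e0).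
exists k.+1 => x y /(@agree_cantor_dist R) xy; apply: lt_trans xy _.
by have := ke k (leqnn k); rewrite /= div1r.
Qed.

Lemma coded_metric_sub (R : realType) (K : set cantor_space) (x0 : K) :
  coded (@metric_sub_val R K x0 : metric_sub R x0 -> nat -> bool).
Proof.
move=> x U; rewrite -nbhs_ballE; split=> [[e /= e0 eU]|[k kU]].
  have [k ke] := cantor_dist_small e0; exists k => y xy; apply: eU.
  rewrite ballEmdist /=; exact: ke.
exists (2 ^- k)%R => /=; first by rewrite invr_gt0 exprn_gt0.
move=> y; rewrite ballEmdist /= => /agree_cantor_dist xy; apply: kU.
exact: agree_le xy.
Qed.

(** Brouwer's characterization applied to [K] with its metric; the homeomorphism obtained is
    composed with the inclusion of [K]. *)
Lemma closed_perfect_cantor (R : realType) (K : set cantor_space) :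
  closed K -> K !=set0 ->
  (forall x k, K x -> exists y, [/\ K y, y <> x & agree k x y]) ->
  exists f : cantor_space -> cantor_space,
    [/\ continuous f, injective f & range f = K].
Proof.
move=> clK [x Kx] Kperf; pose x0 : K := exist _ x (mem_set Kx).
pose S := metric_sub R x0.
have cS : coded (@metric_sub_val R K x0) := @coded_metric_sub R K x0.
have vI : injective (@metric_sub_val R K x0) by exact: val_inj.
have rgv : range (@metric_sub_val R K x0) = K.
  apply/seteqP; split=> [_ [y _ <-]|y Ky]; first exact: set_valP.
  by exists (exist _ y (mem_set Ky)).
have likeS : cantor_like S.
  split.
  - apply/perfectTP_ex => U oU [y Uy].
    have [k kU] := (coded_openP cS U).1 oU y Uy.
    have [z [Kz zy yz]] := Kperf _ k (set_valP (y : K)).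
    exists y, (exist _ z (mem_set Kz) : K); split=> //; first exact: kU.
    by apply/eqP => yE; apply: zy; rewrite yE.
  - by apply: (coded_compact cS); rewrite rgv.
  - exact: (coded_hausdorff cS).
  - exact: (coded_zero_dimensional cS).
have [f [cf _]] := homeomorphism_cantor_like likeS.
exists (@metric_sub_val R K x0 \o f); split.
- apply/(coded_continuousP coded_cantor _ coded_cantor) => y n.
  exact: ((coded_continuousP coded_cantor f cS).1 cf).
- by move=> y z /vI /(@inj _ _ _ f); apply; rewrite in_setT.
- apply: etrans rgv; apply/seteqP; split=> [_ [y _ <-]|_ [y _ <-]]; first by exists (f y).
  by have [z _ zy] := @surj _ _ _ _ f y I; exists z; rewrite //= zy.
Qed.

(** Continuity of the inverse of an embedding: the points that differ from [z] before [n] form a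
    compact set, whose image is closed and misses [h z]. *)
Lemma cantor_inverse_agree (h : cantor_space -> cantor_space) :
  continuous h -> injective h ->
  forall z n, exists m, forall z', agree m (h z) (h z') -> agree n z z'.
Proof.
move=> ch hI z n.
pose A : set cantor_space := [set z' | ~ agree n z z'].
have clA : closed A.
  rewrite -openC; apply/(coded_openP coded_cantor) => y /contrapT zy.
  by exists n => y' yy' /=; apply; exact: agree_trans zy yy'.
have : closed (h @` A).
  apply: (compact_closed cantor_space_hausdorff); apply: continuous_compact.
    exact: continuous_subspaceT.
  exact: subclosed_compact clA cantor_space_compact _.
rewrite -openC => /(coded_openP coded_cantor)/(_ (h z)) [].
  by move=> [z' Az' /hI zz']; apply: Az'; rewrite zz'.
move=> m mA; exists m => z' /mA /= hA.
by apply: contrapT => nz; apply: hA; exists z'.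
Qed.

(** * Homeomorphisms glued over the fibers of locally constant maps *)

Lemma coded_image_closed (X : topologicalType) (v : X -> nat -> bool) (A : set X) :
  coded v -> injective v -> closed (range v : set cantor_space) -> closed A ->
  closed (v @` A : set cantor_space).
Proof.
move=> cv vI clv clA.
apply: (compact_closed cantor_space_hausdorff).
apply: (@continuous_compact X cantor_space v).
  apply: continuous_subspaceT.
  by apply/(coded_continuousP cv _ coded_cantor) => x n; exists n.
exact: subclosed_compact clA (coded_compact cv clv) _.
Qed.

Definition coded_loc_const (X : Type) (v : X -> nat -> bool) (J : Type)
  (e : X -> J) := forall x, exists k, forall y, agree k (v x) (v y) -> e x = e y.

Definition coded_perfect (X : Type) (v : X -> nat -> bool) :=
  forall x k, exists y, y <> x /\ agree k (v x) (v y).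

(** A fiber of a locally constant map is clopen: closedness makes its image under [v] closed, and
    openness lets it inherit the absence of isolated points. *)
Lemma coded_fiber_cantor (R : realType) (X : topologicalType)
    (v : X -> nat -> bool) (J : Type) (e : X -> J) :
  coded v -> injective v -> closed (range v : set cantor_space) ->
  coded_perfect v -> coded_loc_const v e ->
  forall a, (exists x, e x = a) ->
  exists f : cantor_space -> cantor_space, [/\ continuous f, injective f &
    range f = [set v x | x in [set x | e x = a]]].
Proof.
move=> cv vI clv pv le a [x ex]; apply: (closed_perfect_cantor R).
- apply: coded_image_closed => //; rewrite -openC.
  apply/(coded_openP cv) => y /= ya; have [k yk] := le y.
  by exists k => y' /yk <-.
- by exists (v x), x.
- move=> _ k [y /= ya <-]; have [l yl] := le y.
  have [z [zy yz]] := pv y (maxn k l).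
  exists (v z); split; last exact: agree_le (leq_maxl _ _) yz.
    by exists z => //=; rewrite -yl//; apply: agree_le (leq_maxr _ _) yz.
  by move/vI.
Qed.

(* Each fiber of [e] and each fiber of [c] is a Cantor set; [phi] is glued from
   homeomorphisms between corresponding fibers. *)
Lemma fiberwise_homeomorphism (R : realType) (X : topologicalType)
    (v : X -> nat -> bool) (J : Type) (e : X -> J) (c : cantor_space -> J) :
  coded v -> injective v -> closed (range v : set cantor_space) ->
  coded_perfect v -> coded_loc_const v e ->
  coded_loc_const (id : cantor_space -> nat -> bool) c -> range e = range c ->
  exists phi : cantor_space -> X, homeomorphism phi /\ e \o phi = c.
Proof.
move=> cv vI clv pv le lc ec.
have pC : coded_perfect (id : cantor_space -> nat -> bool).
  move=> x k; exists (fun i => if i == k then ~~ x k else x i); split.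
    by move/(congr1 (fun z => z k)); rewrite eqxx; case: (x k).
  by move=> i ik; rewrite ltn_eqF.
have clC : closed (range (id : cantor_space -> nat -> bool) : set cantor_space).
  by rewrite image_id; exact: closedT.
have H_ a : exists H : cantor_space -> cantor_space, range c a ->
    [/\ continuous H, injective H & range H = [set x | c x = a]].
  have [[x _ xa]|] := pselect (range c a); last by exists id.
  have [|H [? ? rH]] :=
    coded_fiber_cantor R coded_cantor (fun _ _ => id) clC pC lc (a := a).
    by exists x.
  by exists H => _; split=> //; rewrite rH image_id.
have F_ a : exists F : cantor_space -> cantor_space, range c a ->
    [/\ continuous F, injective F & range F = [set v x | x in [set x | e x = a]]].
  have [|] := pselect (range c a); last by exists id.
  rewrite -ec => -[x _ xa].
  have [|F ?] := coded_fiber_cantor R cv vI clv pv le (a := a); first by exists x.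
  by exists F.
have [H HP] := choice H_; have [F FP] := choice F_.
(* The points [y] and [phi y] share the parameter [z] in the parametrizations [H] and [F] of their
   fibers. *)
have phi_ y : exists x, exists z, H (c y) z = y /\ v x = F (c y) z.
  have cy : range c (c y) by exists y.
  have [_ _ rH] := HP _ cy; have [_ _ rF] := FP _ cy.
  have [z _ zy] : range (H (c y)) y by rewrite rH.
  have [x _ xz] : [set v x | x in [set x | e x = c y]] (F (c y) z).
    by rewrite -rF; exists z.
  by exists x, z.
have [phi phiP] := choice phi_.
have ephi y : e (phi y) = c y.
  have cy : range c (c y) by exists y.
  have [_ _ rF] := FP _ cy; have [z [_ xz]] := phiP y.
  have [x /= xy xF] : [set v x | x in [set x | e x = c y]] (F (c y) z).
    by rewrite -rF; exists z.
  by rewrite -xy; congr e; apply: vI; rewrite xz.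
have phiI : injective phi.
  move=> y y' yy'; have cyy' : c y = c y' by rewrite -!ephi yy'.
  have cy : range c (c y) by exists y.
  have [_ FI _] := FP _ cy.
  have [z [zy Fz]] := phiP y; have [z' [zy' Fz']] := phiP y'.
  rewrite -zy -zy' -cyy'; congr (H (c y) _); apply: FI.
  by rewrite -Fz yy' Fz' cyy'.
have phiS x : exists y, phi y = x.
  have [y0 _ y0x] : range c (e x) by rewrite -ec; exists x.
  have ca : range c (e x) by exists y0.
  have [_ HI rH] := HP _ ca; have [_ FI rF] := FP _ ca.
  have [z _ zx] : range (F (e x)) (v x) by rewrite rF; exists x.
  exists (H (e x) z).
  have cH : c (H (e x) z) = e x.
    by suff : range (H (e x)) (H (e x) z) by rewrite rH.
  have [z' []] := phiP (H (e x) z); rewrite cH => /HI -> Fz.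
  by apply: vI; rewrite Fz zx.
exists phi; split; last exact/funext.
apply: compact_homeomorphism.
- exact: cantor_space_compact.
- exact: coded_hausdorff cv vI.
- apply/(coded_continuousP coded_cantor _ cv) => y n.
  (* Near [y] the value of [c] is constant, so there [phi], read through [v], is one fixed [F]
     composed with the inverse of one fixed [H]. *)
  have cy : range c (c y) by exists y.
  have [cH HI _] := HP _ cy; have [cF FI _] := FP _ cy.
  have [z [zy Fz]] := phiP y; have [l ly] := lc y.
  have [m1 m1P] := (coded_continuousP coded_cantor _ coded_cantor).1 cF z n.
  have [m2 m2P] := cantor_inverse_agree cH HI z m1.
  exists (maxn l m2) => y' yy'.
  have cyy' : c y = c y' by apply/ly/(agree_le (leq_maxl _ _) yy').
  have [z' [zy' Fz']] := phiP y'.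
  rewrite Fz Fz' -cyy'; apply/m1P/m2P; rewrite [X in agree _ _ (H X _)]cyy' zy' zy.
  exact: agree_le (leq_maxr _ _) yy'.
- exists (fun x => projT1 (cid (phiS x))) => [y|x].
    by apply: phiI; case: cid.
  by case: cid.
Qed.

(** * A family of rank-1 words and their subshifts *)

(** With three copies per level this gives [v_n 1^p v_n 1^q v_n]. Later [p + 1 = L] and
    [q + 1 = 2L]: divisibility by [L] creates the phase, and [p < q] excludes isolated points. *)
Definition spacer (p q _ i : nat) : nat := if i == 1%N then p else q.

Section ternary_word.
Variables p q : nat.

Let v := rank1_word (fun=> 3%N) (spacer p q).
Let s n := size (v n).

Definition ternary_limit : nat -> bool := rank1_limit (fun=> 3%N) (spacer p q).
Local Notation V := ternary_limit.

Lemma ternary_cut : cut_params (fun=> 3%N). Proof. by []. Qed.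

Lemma ternary_wordS n :
  v n.+1 = v n ++ nseq p true ++ v n ++ nseq q true ++ v n.
Proof. by rewrite /v /= cats0 -!catA. Qed.

Lemma ternary_limit_nth n i : (i < s n)%N -> V i = nth false (v n) i.
Proof.
by move=> ilt; rewrite /v -(rank1_limitP (spacer p q) n ternary_cut) nth_mkseq.
Qed.

Lemma ternary_size0 : s 0 = 1%N. Proof. by []. Qed.

Lemma ternary_sizeS n : s n.+1 = (3 * s n + p + q)%N.
Proof. by rewrite /s ternary_wordS !size_cat !size_nseq; lia. Qed.

Lemma ternary_size_ge n : (n < s n)%N.
Proof. exact: size_rank1_word. Qed.

Lemma ternary_limit0 : V 0 = false. Proof. by rewrite (@ternary_limit_nth 0). Qed.

Lemma ternary_limit_gap1 n i : (i < p)%N -> V (s n + i) = true.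
Proof.
move=> ip; rewrite (@ternary_limit_nth n.+1) ?ternary_sizeS; last lia.
rewrite ternary_wordS nth_cat ifF; last by apply/negbTE; rewrite -leqNgt leq_addr.
by rewrite addKn nth_cat size_nseq ip nth_nseq ip.
Qed.

Lemma ternary_limit_copy1 n i : (i < s n)%N -> V (s n + p + i) = V i.
Proof.
move=> isn; rewrite (@ternary_limit_nth n.+1) ?ternary_sizeS; last lia.
rewrite ternary_wordS catA nth_cat size_cat size_nseq -/(s n) ifF; last lia.
by rewrite addKn nth_cat isn (ternary_limit_nth isn).
Qed.

Lemma ternary_limit_gap2 n i : (i < q)%N -> V (2 * s n + p + i) = true.
Proof.
move=> iq; rewrite (@ternary_limit_nth n.+1) ?ternary_sizeS; last lia.
rewrite ternary_wordS 2!catA nth_cat !size_cat size_nseq -/(s n) ifF; last lia.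
rewrite (_ : (_ - _)%N = i); last lia.
by rewrite nth_cat size_nseq iq nth_nseq iq.
Qed.

Lemma ternary_limit_copy2 n i : (i < s n)%N -> V (2 * s n + p + q + i) = V i.
Proof.
move=> isn; rewrite (@ternary_limit_nth n.+1) ?ternary_sizeS; last lia.
rewrite ternary_wordS 3!catA nth_cat !size_cat !size_nseq -/(s n) ifF; last lia.
by rewrite (_ : (_ - _)%N = i) ?(ternary_limit_nth isn)//; lia.
Qed.

Lemma ternary_size_le m n : (m <= n)%N -> (s m <= s n)%N.
Proof.
move=> /subnKC <-; elim: (n - m)%N => [|d]; first by rewrite addn0.
by rewrite addnS ternary_sizeS; lia.
Qed.

(** Occurrences of [v_n] have bounded gaps. Inside [v_(M+1)], either a whole [v_n] starting at [k]
    fits into one copy of [v_M] and induction applies, or the next copy of [v_M] starts soon enough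
    and has [v_n] as a prefix. *)
Lemma ternary_recurrent n N : (n <= N)%N -> forall k, (k + s n <= s N)%N ->
  exists j, [/\ (k <= j <= k + s n + p + q)%N, (j + s n <= s N)%N &
    forall i, (i < s n)%N -> V (j + i) = V i].
Proof.
move=> /subnKC <-; elim: (N - n)%N => [|d IHd] k.
  by rewrite addn0 => ks; exists 0%N; split=> //; lia.
rewrite addnS; set M := (n + d)%N in IHd *.
have snM : (s n <= s M)%N by apply: ternary_size_le; rewrite leq_addr.
rewrite ternary_sizeS => ks.
have [k1|k1] := leqP (k + s n) (s M).
  by have [j [? ? jV]] := IHd k k1; exists j; split=> //; lia.
have [k2|k2] := leqP k (s M + p).
  exists (s M + p)%N; split; [lia|lia|move=> i isn].
  by apply: ternary_limit_copy1; lia.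
have [k3|k3] := leqP (k + s n) (2 * s M + p).
  have [|j [? ? jV]] := IHd (k - (s M + p))%N; first lia.
  exists (s M + p + j)%N; split; [lia|lia|move=> i isn].
  by rewrite -addnA ternary_limit_copy1 ?jV//; lia.
have [k4|k4] := leqP k (2 * s M + p + q).
  exists (2 * s M + p + q)%N; split; [lia|lia|move=> i isn].
  by apply: ternary_limit_copy2; lia.
have [|j [? ? jV]] := IHd (k - (2 * s M + p + q))%N; first lia.
exists (2 * s M + p + q + j)%N; split; [lia|lia|move=> i isn].
by rewrite -addnA ternary_limit_copy2 ?jV//; lia.
Qed.

(** By induction every length [s n] is 1 modulo [L], so each copy of [v_n] in [v_(n+1)] starts at a
    multiple of [L]. *)
Lemma ternary_zeros L i : (L %| p.+1)%N -> (L %| q.+1)%N -> V i = false ->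
  (L %| i)%N.
Proof.
move=> Lp Lq; have sL n : (L %| (s n).-1)%N.
  elim: n => [|n IHn]; first by rewrite ternary_size0.
  rewrite ternary_sizeS; have := ternary_size_ge n => ns.
  have -> : (3 * s n + p + q).-1 = (3 * (s n).-1 + p.+1 + q.+1)%N by lia.
  by rewrite !dvdn_add// dvdn_mull.
suff H n : forall i, (i < s n)%N -> V i = false -> (L %| i)%N.
  exact: H i _ (ternary_size_ge i).
elim: n {i} => [|n IHn] i; first by rewrite ternary_size0 ltnS leqn0 => /eqP->.
have := sL n; have := ternary_size_ge n => ns Ls.
rewrite ternary_sizeS => isn.
have [i1|i1] := ltnP i (s n); first exact: IHn.
have [i2|i2] := ltnP i (s n + p).
  by rewrite -(subnKC i1) ternary_limit_gap1//; lia.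
have [i3|i3] := ltnP i (2 * s n + p).
  rewrite -(subnKC i2) ternary_limit_copy1; last lia.
  have lt : (i - (s n + p) < s n)%N by clear Lp Lq sL Ls IHn; lia.
  move=> /(IHn _ lt) Li; apply: dvdn_add => //.
  have -> : (s n + p)%N = ((s n).-1 + p.+1)%N.
    by clear - ns; rewrite addnS -addSn prednK//; exact: leq_ltn_trans ns.
  by rewrite dvdn_add.
have [i4|i4] := ltnP i (2 * s n + p + q).
  by rewrite -(subnKC i3) ternary_limit_gap2//; lia.
rewrite -(subnKC i4) ternary_limit_copy2; last lia.
have lt : (i - (2 * s n + p + q) < s n)%N by clear Lp Lq sL Ls IHn; lia.
move=> /(IHn _ lt) Li; apply: dvdn_add => //.
have -> : (2 * s n + p + q)%N = (2 * (s n).-1 + p.+1 + q.+1)%N.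
  by clear - ns; lia.
by rewrite !dvdn_add// dvdn_mull.
Qed.

End ternary_word.

Local Open Scope ring_scope.

(** * Windows and binary codes of bi-infinite sequences *)

Lemma subshift_windowP (V : nat -> bool) (x : biinfinite) :
  subshift_of V x <-> forall (k : int) (m : nat), exists j : nat,
    forall i, (i < m)%N -> x (k + i%:Z) = V (j + i)%N.
Proof.
split=> [xV k m|xV w [k ->]].
  have [|j] := xV (mkseq (fun i => x (k + i%:Z)) m).
    by exists k; rewrite size_mkseq.
  rewrite size_mkseq => E; exists j => i im.
  by move: (congr1 (fun u => nth false u i) E); rewrite !nth_mkseq.
have [j jV] := xV k (size w); exists j; rewrite size_mkseq.
apply: (@eq_from_nth _ false); rewrite ?size_mkseq// => i iw.
by rewrite !nth_mkseq// jV.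
Qed.

Definition shiftz (k : int) (x : biinfinite) : biinfinite := fun i => x (k + i).

Lemma subshift_shiftz V k x : subshift_of V x -> subshift_of V (shiftz k x).
Proof.
move=> /subshift_windowP xV; apply/subshift_windowP => l m.
have [j jV] := xV (k + l) m; exists j => i im.
by rewrite -jV// /shiftz addrA.
Qed.

(** Alternating signs make the first [2 * m] codes enumerate exactly the window from [-m] to
    [m - 1]; code 0 is the origin. *)
Definition int_of_code (n : nat) : int := if odd n then Negz n./2 else Posz n./2.

Definition code_of_int (i : int) : nat :=
  match i with Posz n => n.*2 | Negz n => n.*2.+1 end.

Lemma code_of_intK : cancel code_of_int int_of_code.
Proof.
by case=> n; rewrite /int_of_code /= ?odd_double ?doubleK//= uphalf_double.
Qed.

Lemma int_of_codeK : cancel int_of_code code_of_int.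
Proof. by move=> n; rewrite /int_of_code; case: ifP => /= on; lia. Qed.

Definition bicode (x : biinfinite) : nat -> bool := fun n => x (int_of_code n).

Lemma bicode_inj : injective bicode.
Proof.
move=> x y xy; apply/funext => i; rewrite -(code_of_intK i).
exact: (congr1 (fun z => z (code_of_int i)) xy).
Qed.

Lemma coded_bicode : coded bicode.
Proof.
apply: (@coded_bool_prod int (fun k => map int_of_code (iota 0 k))) => [i|k x y].
  exists (code_of_int i).+1; apply/mapP.
  exists (code_of_int i); last by rewrite code_of_intK.
  by rewrite mem_iota add0n ltnS /=.
split=> [xy _ /mapP[n + ->]|xy n nk]; first by rewrite mem_iota => /xy.
by apply: xy; apply/mapP; exists n; rewrite // mem_iota.
Qed.

Lemma agree_code_window (m : nat) (x y : biinfinite) :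
  (forall i : int, - m%:Z <= i < m%:Z -> x i = y i) -> agree m (bicode x) (bicode y).
Proof.
by move=> xy n nm; apply: xy; rewrite /int_of_code; case: ifP => on; lia.
Qed.

Lemma agree_code_in (k : nat) (x y : biinfinite) i :
  agree k (bicode x) (bicode y) -> (code_of_int i < k)%N -> x i = y i.
Proof. by move=> xy /xy; rewrite /bicode code_of_intK. Qed.

Lemma agree_code_nat (m : nat) (x y : biinfinite) i :
  agree (2 * m)%N (bicode x) (bicode y) -> - m%:Z <= i < m%:Z -> x i = y i.
Proof. by move=> xy im; apply: (agree_code_in xy); case: i im => i /=; lia. Qed.

Lemma closed_code_subshift V :
  closed (range (bicode \o set_val : subshift_of V -> nat -> bool) : set cantor_space).
Proof.
rewrite -openC; apply/(coded_openP coded_cantor) => y ny.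
pose x : biinfinite := fun i => y (code_of_int i).
have xy : bicode x = y by apply/funext => n; rewrite /bicode /x int_of_codeK.
have : ~ subshift_of V x.
  by move=> Vx; apply: ny; exists (exist _ x (mem_set Vx)).
move=> /subshift_windowP/existsNP[l /existsNP[m lm]].
(* This prefix of the code determines the forbidden window of length [m] at [l]. *)
exists (2 * (`|l| + m))%N => _ /[swap] -[z _ <-] yz; apply: lm.
have /subshift_windowP/(_ l m)[j jV] := set_valP z.
exists j => i im; rewrite -jV//; apply: (@agree_code_nat (`|l| + m)%N).
  by rewrite xy.
lia.
Qed.

Section ternary_subshift.
Variables p q : nat.
Local Notation V := (ternary_limit p q).
Let s n := size (rank1_word (fun=> 3%N) (spacer p q) n).

(* [ternary_center n] is where the origin of the limit point sits when [v_n]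
   is taken as the middle copy inside [v_n.+1]. *)
Fixpoint ternary_center (n : nat) : nat :=
  if n is m.+1 then (s m + p + ternary_center m)%N else 0%N.
Local Notation o := ternary_center.

Lemma ternary_center_ge n : (n <= o n)%N.
Proof. by elim: n => //= n IHn; have := ternary_size_ge p q n; rewrite -/(s n); lia. Qed.

Lemma ternary_center_lt n : (o n + n < s n)%N.
Proof.
elim: n => //= n IHn; have := ternary_size_ge p q n.
by rewrite /s ternary_sizeS -/(s n); lia.
Qed.

(** The two-sided limit of the nested middle copies. Stage [|k|] already covers coordinate [k],
    because the center is at distance at least [n] from the left end of [v_n] and more than [n] from
    its right end. *)
Definition ternary_point : biinfinite := fun k => V (absz ((o `|k|%N)%:Z + k)%R).

Lemma ternary_pointE n k : - (o n)%:Z <= k < (s n)%:Z - (o n)%:Z ->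
  ternary_point k = V (absz ((o n)%:Z + k)%R).
Proof.
move=> kn; rewrite /ternary_point.
have step (a d : nat) : - (o a)%:Z <= k < (s a)%:Z - (o a)%:Z ->
    V (absz ((o (a + d))%:Z + k)%R) = V (absz ((o a)%:Z + k)%R).
  move=> ka; elim: d => [|d]; first by rewrite addn0.
  move=> <-; rewrite addnS /=.
  (* The copy of [v_a] around the origin stays inside [v_(a+d)], so [ternary_limit_copy1] applies
     one stage further. *)
  have sd : (o a <= o (a + d))%N /\ (o (a + d) + (s a - o a) <= s (a + d))%N.
    elim: d => [|d [IH1 IH2]]; first by have := ternary_center_lt a; rewrite addn0; lia.
    by rewrite addnS /s ternary_sizeS -!/(s _) /=; lia.
  rewrite (_ : absz _ = (s (a + d) + p + (absz ((o (a + d))%:Z + k)%R))%N); last lia.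
  by rewrite ternary_limit_copy1// -/(s _); lia.
have kk : - (o `|k|%N)%:Z <= k < (s `|k|%N)%:Z - (o `|k|%N)%:Z.
  by have := ternary_center_ge `|k|%N; have := ternary_center_lt `|k|%N; lia.
by case: (leqP n `|k|%N) => [|/ltnW] /subnKC E; rewrite -E step.
Qed.

Lemma ternary_point_subshift : subshift_of V ternary_point.
Proof.
apply/subshift_windowP => k m; pose n := (`|k| + m)%N.
exists (absz ((o n)%:Z + k)%R) => i im.
have := ternary_center_ge n; have := ternary_center_lt n => on1 on2.
rewrite (@ternary_pointE n); last by rewrite /n in on1 on2 *; lia.
by congr V; rewrite /n in on1 on2 *; lia.
Qed.

Lemma ternary_point_prefix n i : (i < s n)%N ->
  ternary_point (i%:Z - (o n)%:Z) = V i.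
Proof. by move=> isn; rewrite (@ternary_pointE n)//; [congr V|]; lia. Qed.

Lemma ternary_subshift_occ (x : biinfinite) n : subshift_of V x ->
  exists j : int, forall i, (i < s n)%N -> x (j + i%:Z) = V i.
Proof.
(* By recurrence an occurrence of [v_n] starts within [s n + p + q] of the left end, so a window of
   this length contains all of it. *)
move=> /subshift_windowP/(_ 0 (3 * s n + p + q)%N)[j jV].
pose N := (n + (j + s n))%N.
have jN : (j + s n <= s N)%N.
  by apply: leq_trans (ltnW (ternary_size_ge p q N)); rewrite leq_addl.
have [l [jl lN lV]] := ternary_recurrent (leq_addr _ n) jN.
exists (l%:Z - j%:Z) => i isn; rewrite -lV//.
have := jV (l - j + i)%N ltac:(rewrite -/(s n) in jl; lia).
have -> : 0 + (l - j + i)%N%:Z = l%:Z - j%:Z + i%:Z by lia.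
by have -> : (j + (l - j + i) = l + i)%N by lia.
Qed.

Lemma ternary_subshift_window (z : biinfinite) m : subshift_of V z ->
  exists n j, (j + 2 * m <= s n)%N /\
    forall i, (i < 2 * m)%N -> z (i%:Z - m%:Z) = V (j + i)%N.
Proof.
move=> /subshift_windowP/(_ (- m%:Z) (2 * m)%N)[j jV].
exists (j + 2 * m)%N, j; split; first exact/ltnW/ternary_size_ge.
by move=> i im; rewrite -jV// addrC.
Qed.

(** The central window of [z] is a subword of some [v_n], and [v_n] occurs in [x]. *)
Lemma ternary_subshift_minimal (x z : biinfinite) m :
  subshift_of V x -> subshift_of V z ->
  exists k : int, agree m (bicode z) (bicode (shiftz k x)).
Proof.
move=> Vx /(ternary_subshift_window m)[n [j [jm jV]]].
have [l lV] := ternary_subshift_occ n Vx.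
exists (l + j%:Z + m%:Z); apply: agree_code_window => i im; rewrite /shiftz.
have := jV (absz (i + m%:Z)%R) ltac:(lia).
rewrite (_ : _ - _ = i) => [->|]; last lia.
by rewrite -lV; [congr x|]; lia.
Qed.

(** The central window of [z] sits inside some [v_n]. Placing it in the first or in the second copy
    of [v_n] inside [v_(n+1)] gives two points close to [z]; they differ since the copies are
    followed by gaps of lengths [p < q], so one of them is not [z]. *)
Lemma ternary_subshift_perfect (z : biinfinite) m : (p < q)%N ->
  subshift_of V z ->
  exists y, [/\ subshift_of V y, y <> z & agree m (bicode z) (bicode y)].
Proof.
move=> pq /(ternary_subshift_window m)[n [j [jm jV]]].
pose y (a : nat) := shiftz (a%:Z + j%:Z + m%:Z - (o n.+1)%:Z) ternary_point.
have yV a : subshift_of V (y a) by apply/subshift_shiftz/ternary_point_subshift.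
have yE (a : nat) (i : int) (b : nat) : b%:Z = a%:Z + j%:Z + m%:Z + i ->
    (b < s n.+1)%N -> y a i = V b.
  move=> bE bs; rewrite /y /shiftz -(ternary_point_prefix bs).
  by congr ternary_point; lia.
have sSn := ternary_sizeS p q n; rewrite -!/(s _) in sSn.
have yz (a : nat) : (a + s n <= s n.+1)%N ->
    (forall i, (i < s n)%N -> V (a + i)%N = V i) -> agree m (bicode z) (bicode (y a)).
  move=> asn aV; apply: agree_code_window => i im.
  have := jV (absz (i + m%:Z)%R) ltac:(lia).
  rewrite (_ : _ - _ = i) => [->|]; last lia.
  rewrite (yE a i (a + (j + (absz (i + m%:Z)%R)))%N); [|lia|lia].
  by rewrite aV//; lia.
(* Seen from [y 0], this is the first letter after the gap [1^p], a zero; seen from [y (s n + p)] it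
   still lies in the gap [1^q]. *)
pose d : int := (s n)%:Z + p%:Z - j%:Z - m%:Z.
have ynd : y 0%N <> y (s n + p)%N.
  move=> /(congr1 (fun u => u d)).
  have sn0 := ternary_size_ge p q n; rewrite -!/(s _) in sn0.
  rewrite (yE _ _ (s n + p)%N); [|rewrite /d; lia|lia].
  rewrite (yE _ _ (2 * s n + p + p)%N); [|rewrite /d; lia|lia].
  rewrite ternary_limit_gap2// -[(s n + p)%N]addn0 ternary_limit_copy1; last first.
    by rewrite -/(s n); lia.
  by rewrite ternary_limit0.
have [y0z|y0z] := pselect (y 0%N = z).
  exists (y (s n + p)%N); split=> //; first by rewrite -y0z; exact/nesym.
  by apply: yz => [|i isn]; [lia|exact: ternary_limit_copy1].
by exists (y 0%N); split=> //; apply: yz => //; lia.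
Qed.

Lemma ternary_subshift_zeros L (x : biinfinite) (a b : int) :
  (L %| p.+1)%N -> (L %| q.+1)%N -> subshift_of V x ->
  x a = false -> x b = false -> (a = b %[mod L])%Z.
Proof.
move=> Lp Lq xV; wlog ab : a b / a <= b => [H xa xb|].
  by have /orP[ab|ba] := le_total a b; [exact: H|apply/esym/H].
have /subshift_windowP/(_ a (absz (b - a)%R).+1)[j jV] := xV.
move=> xa xb; apply/eqP; rewrite eq_sym eqz_mod_dvd.
have V1 := jV 0%N isT; have V2 := jV (absz (b - a)%R) (ltnSn _).
rewrite addr0 xa addn0 in V1; rewrite (_ : a + _ = b) ?xb in V2; last lia.
have L1 := ternary_zeros Lp Lq (esym V1).
by have := ternary_zeros Lp Lq (esym V2); rewrite dvdn_addr.
Qed.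

End ternary_subshift.

Lemma iter_subshift_map V n (x : subshift_of V) :
  set_val (iter n (@subshift_map V) x) = shiftz n%:Z (set_val x).
Proof.
elim: n => [|n IHn]; apply/funext => i; first by rewrite /shiftz add0r.
have /(congr1 (fun u : biinfinite => u (i + 1))) E := IHn.
by apply: etrans E _; rewrite /shiftz; congr (set_val x _); lia.
Qed.

Lemma subshift_map_bij V : bijective (@subshift_map V).
Proof.
pose g (x : subshift_of V) : subshift_of V :=
  exist _ (shiftz (-1) (set_val x)) (mem_set (@subshift_shiftz V (-1) _ (set_valP x))).
exists g => x; apply: val_inj; apply/funext => i;
  rewrite /= /shiftz /bishift /=; congr (sval x _); lia.
Qed.

Lemma coded_subshift V : coded (bicode \o set_val : subshift_of V -> nat -> bool).
Proof. exact: (@coded_initial biinfinite bicode (subshift_of V) coded_bicode). Qed.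

Lemma subshift_code_inj V : injective (bicode \o set_val : subshift_of V -> nat -> bool).
Proof. by move=> x y /bicode_inj/val_inj. Qed.

Lemma subshift_map_continuous V : continuous (@subshift_map V).
Proof.
apply/(coded_continuousP (@coded_subshift V) _ (@coded_subshift V)) => x n.
exists (2 * n.+1)%N => y xy; apply: agree_code_window => i im.
by rewrite /= /bishift; apply: (agree_code_nat xy); lia.
Qed.

(** The phase is minus the position of any zero, modulo [L]. It depends on one coordinate locally,
    and the shift moves zeros one step left, hence the sign. *)
Lemma ternary_phase (L : nat) : (0 < L)%N ->
  let V := ternary_limit L.-1 (2 * L).-1 in
  exists pi : subshift_of V -> nat,
  [/\ forall x, (pi x < L)%N,
      forall x, pi (subshift_map x) = (pi x).+1 %% L,
      coded_loc_const (bicode \o set_val) pi &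
      forall i, (i < L)%N -> exists x, pi x = i]%N.
Proof.
move=> L0 V.
have L1 : (L %| (L.-1).+1)%N by rewrite prednK.
have L2 : (L %| ((2 * L).-1).+1)%N by rewrite prednK ?dvdn_mull//; lia.
have zero (x : subshift_of V) : exists j, set_val x j = false.
  have [j jV] := ternary_subshift_occ 0 (set_valP x).
  by exists j; have := jV 0%N isT; rewrite addr0 ternary_limit0.
have [z zP] := choice zero.
have zE (x : subshift_of V) a : set_val x a = false -> (a = z x %[mod L])%Z.
  by move=> xa; exact: (ternary_subshift_zeros L1 L2 (set_valP x) xa (zP x)).
pose pi x := absz (- z x %% L)%Z.
have piE x : (pi x)%:Z = (- z x %% L)%Z.
  by rewrite gez0_abs// modz_ge0//; lia.
have piS x : pi (subshift_map x) = ((pi x).+1 %% L)%N.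
  apply/eqP; rewrite -eqz_nat -modz_nat -addn1 PoszD !piE modzDml.
  have /eqP : (z (subshift_map x) + 1 = z x %[mod L])%Z.
    by apply: zE; have := zP (subshift_map x).
  rewrite eqz_mod_dvd => d; rewrite eqz_mod_dvd.
  suff -> : - z (subshift_map x) - (- z x + 1) = - (z (subshift_map x) + 1 - z x).
    by rewrite rpredN.
  by lia.
have piL x : (pi x < L)%N.
  by rewrite -ltz_nat piE ltz_pmod//; lia.
exists pi; split => //.
  move=> x; exists (code_of_int (z x)).+1 => y /agree_code_in/(_ (ltnSn _)) xy.
  apply/eqP; rewrite -eqz_nat !piE eqz_mod_dvd.
  have /zE/eqP : set_val y (z x) = false by rewrite -xy zP.
  by rewrite eqz_mod_dvd => d; rewrite opprK addrC -opprB rpredN.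
pose x0 : subshift_of V := exist _ (ternary_point L.-1 (2 * L).-1)
  (mem_set (@ternary_point_subshift L.-1 (2 * L).-1)).
have piI n : pi (iter n (@subshift_map V) x0) = ((pi x0 + n) %% L)%N.
  elim: n => [|n IHn]; first by rewrite addn0 modn_small.
  by rewrite iterS piS IHn -addn1 modnDml addn1 addnS.
move=> i iL; exists (iter (L - pi x0 + i) (@subshift_map V) x0).
by rewrite piI addnA subnKC ?modnDl ?modn_small// ltnW.
Qed.

(** * Approximation of minimal homeomorphisms *)

Section minimal_compact.
Variables (X : topologicalType) (T : X -> X).
Hypotheses (cX : compact [set: X]) (hT : homeomorphism T) (mT : minimal T).

Lemma continuous_iter (f : X -> X) n : continuous f -> continuous (iter n f).
Proof.
move=> cf; elim: n => [x|n IHn x]; first exact: cvg_id.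
by apply: (@continuous_comp _ _ _ (iter n f) f); [exact: IHn|exact: cf].
Qed.

(* A cluster point of the forward orbit has its whole two-sided orbit in the
   cluster set. *)
Lemma forward_orbit_dense (U : set X) x : open U -> U !=set0 ->
  exists n, U (iter n T x).
Proof.
move=> oU U0; have [g [Tg gT cT cg]] := hT.
have Tgn n : cancel (iter n T) (iter n g).
  by elim: n => // n IHn y; rewrite iterSr iterS Tg IHn.
have gTn n : cancel (iter n g) (iter n T).
  by elim: n => // n IHn y; rewrite iterSr iterS gT IHn.
have [z [_ zc]] := @cX ((fun n => iter n T x) @ \oo) _ filterT.
have visit m (W : set X) : open W -> W z -> exists2 n, (m <= n)%N & W (iter n T x).
  move=> oW Wz.
  have [] := zc [set y | exists2 n, (m <= n)%N & iter n T x = y] W.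
  - by exists m => // n /= mn; exists n.
  - exact: open_nbhs_nbhs.
  by move=> _ [/= [n mn <-] Wn]; exists n.
have [y [Uy [k [zy|yz]]]] := mT z U0 oU.
  have [||n _ Wn] := visit 0%N (iter k T @^-1` U).
  - by apply: open_comp => // u _; exact: continuous_iter.
  - by rewrite /= zy.
  by exists (k + n)%N; rewrite iterD.
(* Here [y] lies [k] steps before the cluster point; a visit at a time [n >= k] can be pulled back
   by [k] without leaving the forward orbit. *)
have [| |n kn Wn] := visit k (iter k g @^-1` U).
- by apply: open_comp => // u _; exact: continuous_iter.
- by rewrite /= -yz Tgn.
by exists (n - k)%N; move: Wn; rewrite /= -{1}(subnKC kn) iterD Tgn.
Qed.

End minimal_compact.

Lemma cantor_closed_walk (T : cantor_space -> cantor_space) (J : finType)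
    (c : cantor_space -> J) x0 :
  homeomorphism T -> minimal T ->
  coded_loc_const (id : cantor_space -> nat -> bool) c ->
  exists L, [/\ (0 < L)%N, c (iter L T x0) = c x0 &
    forall y, exists2 i, (i < L)%N & c (iter i T x0) = c y].
Proof.
move=> hT mT lc.
have visit x y : exists n, c (iter n T x) = c y.
  apply: (@forward_orbit_dense _ _ cantor_space_compact hT mT [set z | c z = c y]).
    apply/(coded_openP coded_cantor) => z /= <-.
    by have [k kz] := lc z; exists k => z' /kz ->.
  by exists y.
have n_ a : exists n, (exists y, c y = a) -> c (iter n T x0) = a.
  have [[y <-]|ny] := pselect (exists y, c y = a); last by exists 0%N.
  by have [n nE] := visit x0 y; exists n.
have [n nP] := choice n_.
(* All attained values are seen by time [M]; the return to the value of [x0] is sought only after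
   time [M + 1], so that the closed walk is long enough. *)
pose M := \max_a n a; have [m mE] := visit (iter M.+1 T x0) x0.
exists (m + M.+1)%N; split; first by rewrite addnS.
  by rewrite iterD.
move=> y; exists (n (c y)); last by apply: nP; exists y.
by rewrite addnS ltnS (leq_trans (leq_bigmax _))// leq_addl.
Qed.

Lemma minimal_autP (R : realType) (T : minimal_aut R) :
  homeomorphism (aut_fun (set_val T)) /\ minimal (aut_fun (set_val T)).
Proof. by split; [exact: set_valP (set_val T)|exact: set_valP T]. Qed.

Lemma minimal_aut_ex (R : realType) (t : cantor_space -> cantor_space) :
  homeomorphism t -> minimal t ->
  exists T : minimal_aut R, aut_fun (set_val T) = t.
Proof.
move=> ht mt; pose T0 : cantor_aut R := exist _ t (mem_set ht).
by exists (exist _ T0 (mem_set (mt : minimal_aut R T0))).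
Qed.

Lemma iter_semiconj (A B : Type) (f : A -> A) (g : B -> B) (h : A -> B) n x :
  (forall x, h (f x) = g (h x)) -> h (iter n f x) = iter n g (h x).
Proof. by move=> hfg; elim: n => //= n <-. Qed.

Lemma conjugate_ternary_minimal p q (f : cantor_space -> cantor_space)
    (phi : cantor_space -> subshift_of (ternary_limit p q)) :
  homeomorphism phi -> phi \o f = @subshift_map _ \o phi ->
  minimal f.
Proof.
set V := ternary_limit p q => -[psi [phiK psiK _ cpsi]] fphi y U [z Uz] oU.
have : nbhs (phi z) (psi @^-1` U).
  by apply: cpsi; rewrite phiK; exact: open_nbhs_nbhs.
move=> /(@coded_subshift V)[m mU].
have [k /= zk] := ternary_subshift_minimal m (set_valP (phi y)) (set_valP (phi z)).
have fphi' x : phi (f x) = subshift_map (phi x).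
  exact: (congr1 (fun h => h x) fphi).
pose x : subshift_of V := exist _ (shiftz k (set_val (phi y)))
  (mem_set (@subshift_shiftz V k _ (set_valP (phi y)))).
exists (psi x); split; first exact: mU.
(* A negative shift [Negz n] is [-(n + 1)], whence [n.+1] and the backward half of the orbit. *)
case: k @x zk => n x _; [exists n; left|exists n.+1; right].
- apply: (can_inj phiK); rewrite psiK (iter_semiconj _ _ fphi').
  by apply: val_inj; rewrite [LHS]iter_subshift_map.
apply: (can_inj phiK); rewrite (iter_semiconj _ _ fphi') psiK.
apply: val_inj; apply: (etrans (iter_subshift_map n.+1 x)); apply/funext => i.
by rewrite /shiftz /=; congr (sval (phi y) _); lia.
Qed.

Lemma conjugate_ternary_aut (R : realType) p q
    (phi : cantor_space -> subshift_of (ternary_limit p q)) :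
  homeomorphism phi -> exists S : minimal_aut R,
    phi \o aut_fun (set_val S) = @subshift_map _ \o phi.
Proof.
set V := ternary_limit p q => hphi; have [psi [phiK psiK cphi cpsi]] := hphi.
pose f := psi \o @subshift_map V \o phi.
have fphi : phi \o f = @subshift_map V \o phi by apply/funext => y /=; rewrite psiK.
have hf : homeomorphism f.
  apply: compact_homeomorphism.
  - exact: cantor_space_compact.
  - exact: cantor_space_hausdorff.
  - move=> y; apply: (@continuous_comp _ _ _ phi); first exact: cphi.
    apply: (@continuous_comp _ _ _ (@subshift_map V)); last exact: cpsi.
    exact: subshift_map_continuous.
  - apply: bij_comp; last by exists psi.
    by apply: bij_comp; [exists phi|exact: subshift_map_bij].
have mf : minimal f by exact: conjugate_ternary_minimal hphi fphi.
by have [S SE] := minimal_aut_ex R hf mf; exists S; rewrite SE.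
Qed.

Lemma coded_perfect_ternary p q : (p < q)%N ->
  coded_perfect (bicode \o set_val : subshift_of (ternary_limit p q) -> nat -> bool).
Proof.
move=> pq x k.
have [y [Vy yx xy]] := ternary_subshift_perfect k pq (set_valP x).
exists (exist _ y (mem_set Vy)); split=> // E; apply: yx.
by rewrite -E.
Qed.

(** Starting point of the Baire-type construction. Constant maps to [unit] have a single fiber, so
    the gluing yields a homeomorphism onto the whole subshift. *)
Lemma minimal_aut_inhabited (R : realType) : exists S : minimal_aut R, True.
Proof.
pose x0 : subshift_of (ternary_limit 0 1) :=
  exist _ (ternary_point 0 1) (mem_set (@ternary_point_subshift 0 1)).
have rtt : range (fun _ : subshift_of (ternary_limit 0 1) => tt) =
    range (fun _ : cantor_space => tt).
  by apply/seteqP; split=> -[] _; [exists point|exists x0].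
have [phi [hphi _]] := @fiberwise_homeomorphism R _ _ unit (fun=> tt) (fun=> tt)
  (@coded_subshift _) (@subshift_code_inj _) (@closed_code_subshift _)
  (@coded_perfect_ternary 0 1 isT) (fun=> ex_intro _ 0%N (fun _ _ => erefl))
  (fun=> ex_intro _ 0%N (fun _ _ => erefl)) rtt.
by have [S _] := conjugate_ternary_aut R hphi; exists S.
Qed.

(** Here [N] bounds the mesh of the partition from below in coordinates, and [k] is the number of
    coordinates that [p] reads. *)
Definition cyclic_coding (S : cantor_space -> cantor_space) (N L k : nat)
    (p : cantor_space -> nat) : Prop :=
  [/\ forall y, (p y < L)%N,
      forall y y', agree k y y' -> p y = p y',
      forall y y', p y = p y' -> agree N y y' &
      forall y, p (S y) = ((p y).+1 %% L)%N].

(** The open sets [F k] of points where [k] coordinates decide the value of [c] cover the compact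
    space; the largest index of a finite subcover works everywhere. *)
Lemma coded_loc_const_uniform (J : Type) (c : cantor_space -> J) :
  coded_loc_const (id : cantor_space -> nat -> bool) c ->
  exists k, forall y y', agree k y y' -> c y = c y'.
Proof.
move=> lc; pose F k : set cantor_space := [set y | forall y', agree k y y' -> c y = c y'].
have := cantor_space_compact; rewrite compact_cover => /(_ nat setT F) [k _|y _|D _ DF].
- apply/(coded_openP coded_cantor) => y Fy; exists k => z yz z' zz'.
  by rewrite -(Fy z)// (Fy z')//; exact: agree_trans yz zz'.
- by have [k ky] := lc y; exists k.
exists (\max_(k <- finmap.enum_fset D) k) => y y' yy'; have [k kD kF] := DF y I.
by apply: kF; apply: agree_le yy'; exact: (leq_bigmax_seq (F := id) k).
Qed.

Lemma rank1_approximation (R : realType) (T : minimal_aut R) N :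
  exists S : minimal_aut R,
    [/\ conjugate_to_rank1 (aut_fun (set_val S)),
        forall y, agree N (aut_fun (set_val T) y) (aut_fun (set_val S) y) &
        exists L k p, cyclic_coding (aut_fun (set_val S)) N L k p].
Proof.
have [] := minimal_autP T; set t := aut_fun _ => ht mt.
pose pre (x : cantor_space) : {ffun 'I_N -> bool} := [ffun i : 'I_N => x i].
have preP x y : pre x = pre y <-> agree N x y.
  split=> [/ffunP xy i iN|xy]; first by have := xy (Ordinal iN); rewrite !ffunE.
  by apply/ffunP => i; rewrite !ffunE xy.
pose c x := (pre x, pre (t x)).
have lc : coded_loc_const (id : cantor_space -> nat -> bool) c.
  move=> x; have [g [_ _ ct _]] := ht.
  have [m mN] := (coded_continuousP coded_cantor _ coded_cantor).1 ct x N.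
  exists (maxn N m) => y xy; congr (_, _); apply/preP.
    exact: agree_le (leq_maxl _ _) xy.
  by apply/mN/(agree_le (leq_maxr _ _) xy).
have [L [L0 cL cy]] := cantor_closed_walk point ht mt lc.
have [pi [piL piS lpi pi_surj]] := ternary_phase L0.
set V := ternary_limit _ _ in pi piL piS lpi pi_surj.
pose w i := c (iter i t point).
(* Consecutive labels match, also across the wrap from [L - 1] to 0, because the walk returns to its
   initial atom. *)
have wmod i : (i < L)%N -> (w (i.+1 %% L)%N).1 = (w i).2.
  rewrite leq_eqVlt => /predU1P[iL|iL]; last by rewrite modn_small.
  rewrite iL modnn {1}/w -cL -iL; exact: erefl.
pose e x := w (pi x).
have le : coded_loc_const (bicode \o set_val) e.
  by move=> x; have [k kx] := lpi x; exists k => y /kx; rewrite /e => ->.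
have rec : range e = range c.
  apply/seteqP; split=> [_ [x _ <-]|_ [y _ <-]]; first by exists (iter (pi x) t point).
  have [i iL iy] := cy y; have [x xi] := pi_surj i iL.
  by exists x; rewrite // /e xi.
have [phi [hphi ephi]] := fiberwise_homeomorphism R (@coded_subshift V)
  (@subshift_code_inj V) (@closed_code_subshift V)
  (coded_perfect_ternary (p := L.-1) (q := (2 * L).-1) ltac:(lia)) le lc rec.
have [_ [_ _ cphi _]] := hphi.
have ephi' y : w (pi (phi y)) = c y by exact: (congr1 (fun h => h y) ephi).
have [S fphi] := conjugate_ternary_aut R hphi; exists S.
set f := aut_fun _ in fphi *.
have piphi y : pi (phi (f y)) = ((pi (phi y)).+1 %% L)%N.
  by rewrite -piS; exact: (congr1 (fun h => pi (h y)) fphi).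
split.
- by exists (fun=> 3%N), (spacer L.-1 (2 * L).-1); split=> //; exists phi.
- move=> y; apply/preP.
  (* The target prefix of the current phase is the source prefix of the next phase, which is that of
     [f y]. *)
  have -> : pre (t y) = (w (pi (phi y))).2 by rewrite ephi'.
  by rewrite -wmod// -piphi ephi'.
have [k kP] : exists k, forall y y', agree k y y' -> pi (phi y) = pi (phi y').
  apply: (@coded_loc_const_uniform nat (pi \o phi)) => y.
  have [n nP] := lpi (phi y).
  have [m mP] := (coded_continuousP coded_cantor phi (@coded_subshift V)).1 cphi y n.
  by exists m => y' /mP /nP.
exists L, k, (pi \o phi); split=> //= y y' E.
apply/preP; suff : c y = c y' by case.
by rewrite -!ephi' E.
Qed.

(** * Limits of cyclic codings *)

Lemma modn_succ_inj (L a b : nat) : (a < L)%N -> (b < L)%N ->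
  (a.+1 %% L = b.+1 %% L)%N -> a = b.
Proof.
move=> aL bL /eqP; rewrite -(addn1 a) -(addn1 b) eqn_modDr !modn_small//.
by move/eqP.
Qed.

(** The prefix of [y] fixes its phase, hence that of [t y]: continuity. Running through the cycle
    brings any orbit near any point: minimality. The phase of [t y] fixes that of [y]: injectivity.
    Surjectivity holds since [range t] is closed and the orbit of [t z] approaches [z]. *)
Lemma cyclic_coding_odometer (t : cantor_space -> cantor_space) :
  (forall n, exists L k p, cyclic_coding t n L k p) ->
  homeomorphism t /\ minimal t.
Proof.
move=> tP.
have ct : continuous t.
  apply/(coded_continuousP coded_cantor _ coded_cantor) => y n.
  have [L [k [p [_ pk pn pt]]]] := tP n.
  by exists k => y' /pk yy'; apply: pn; rewrite !pt yy'.
have iterE n L k p : cyclic_coding t n L k p ->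
    forall m y, p (iter m t y) = ((p y + m) %% L)%N.
  move=> [pL _ _ pt] m y; elim: m => [|m IHm]; first by rewrite addn0 modn_small.
  by rewrite iterS pt IHm -addn1 modnDml addn1 addnS.
have visit y z n : exists m, agree n z (iter m t y).
  have [L [k [p pP]]] := tP n; have [pL _ pn _] := pP.
  exists (L - p y + p z)%N; apply: pn; rewrite (iterE _ _ _ _ pP).
  by rewrite addnA subnKC ?modnDl ?modn_small// ltnW.
split; last first.
  move=> y U [z Uz] oU; have [n nU] := (coded_openP coded_cantor U).1 oU z Uz.
  have [m mP] := visit y z n.
  by exists (iter m t y); split; [exact: nU|exists m; left].
have tI : injective t.
  move=> y y' tyy'; apply: agree_eq => n.
  have [L [k [p [pL _ pn pt]]]] := tP n; apply: pn.
  have := pt y; rewrite tyy' pt.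
  by move/esym/(modn_succ_inj (pL _) (pL _)).
have tS z : exists y, t y = z.
  have cl : closed (range t).
    apply: (compact_closed cantor_space_hausdorff); apply: continuous_compact.
      exact: continuous_subspaceT.
    exact: cantor_space_compact.
  suff [y _ yz] : range t z by exists y.
  have /closure_id -> := cl; move=> B /coded_cantor[n nB].
  have [m mP] := visit (t z) z n.
  exists (iter m t (t z)); split; last exact: nB.
  by exists (iter m t z); rewrite // -iterS iterSr.
apply: compact_homeomorphism => //.
- exact: cantor_space_compact.
- exact: cantor_space_hausdorff.
- exists (fun z => projT1 (cid (tS z))) => [y|z].
    by apply: tI; case: cid.
  by case: cid.
Qed.

(* A rank-1 subshift is expansive, which a homeomorphism with arbitrarily fine
   cyclic codings is not. *)
Lemma cyclic_coding_not_rank1 (t : cantor_space -> cantor_space) :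
  (forall n, exists L k p, cyclic_coding t n L k p) -> ~ conjugate_to_rank1 t.
Proof.
move=> tP [r [s [_ [phi [[psi [phiK psiK cphi _]] phit]]]]].
set V := rank1_limit r s in phi psi phiK psiK cphi phit.
have [[g [tg gt _ _]] _] := cyclic_coding_odometer tP.
(* By compactness [n] coordinates of [y] decide the symbol of [phi y] at the origin; a coding of
   mesh [n] then controls this symbol along whole orbits. *)
have [n nP] : exists n, forall y y', agree n y y' ->
    set_val (phi y) 0 = set_val (phi y') 0.
  apply: (@coded_loc_const_uniform bool (fun y => set_val (phi y) 0)) => y.
  have [m mP] := (coded_continuousP coded_cantor phi (@coded_subshift V)).1 cphi y 1%N.
  by exists m => y' /mP /(_ 0%N isT).
have [L [k [p [pL pk pn pt]]]] := tP n.
pose y : cantor_space := fun=> false; pose y' : cantor_space := fun i => i == k.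
have yy' : y <> y' by move/(congr1 (fun u => u k)); rewrite /y /y' eqxx.
have pyy' : p y = p y' by apply: pk => i ik; rewrite /y /y' ltn_eqF.
have pt' u u' : p u = p u' -> p (t u) = p (t u') by move=> uu'; rewrite !pt uu'.
(* Equality of phases also propagates backwards, since the successor modulo [L] is injective. *)
have pg u u' : p u = p u' -> p (g u) = p (g u').
  move=> uu'; have := pt (g u); rewrite gt uu' -{1}(gt u') pt.

  by move/(modn_succ_inj (pL _) (pL _)).
have phit' u : phi (t u) = subshift_map (phi u).
  exact: (congr1 (fun h => h u) phit).
apply/yy'/(can_inj phiK)/val_inj/funext.
have itn m u u' : p u = p u' -> p (iter m t u) = p (iter m t u').
  by move=> uu'; elim: m => // m; exact: pt'.
have ign m u u' : p u = p u' -> p (iter m g u) = p (iter m g u').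
  by move=> uu'; elim: m => // m; exact: pg.
have gtn m : cancel (iter m g) (iter m t).
  by elim: m => // m IHm u; rewrite iterSr iterS gt IHm.
have phin m u : set_val (phi (iter m t u)) = shiftz m%:Z (set_val (phi u)).
  by rewrite (iter_semiconj _ _ phit') iter_subshift_map.
case=> m.
  have := nP _ _ (pn _ _ (itn m _ _ pyy')).
  by rewrite !phin /shiftz addr0.
have := nP _ _ (pn _ _ (ign m.+1 _ _ pyy')).
have E u : set_val (phi u) (Negz m) = set_val (phi (iter m.+1 g u)) 0.
  by rewrite -{1}(gtn m.+1 u) phin /shiftz; congr (set_val _ _); lia.
by rewrite -!E.
Qed.

(** * The Baire-type construction among minimal homeomorphisms *)

Section minimal_aut_topology.
Variable R : realType.
Implicit Types S T : minimal_aut R.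
Local Notation F T := (aut_fun (set_val T)).

Lemma open_minimal_aut (U : set (minimal_aut R)) T : open U -> U T ->
  exists k, forall S, (forall y, agree k (F T y) (F S y)) -> U S.
Proof.
move=> [B oB <-] /= BT.
have : nbhs (set_val T) B by exact: open_nbhs_nbhs.
rewrite -nbhs_ballE => -[e /= e0 eB].
(* Pointwise strict bounds only give a weak bound on the supremum, hence the halving. *)
have e20 : 0 < e / 2 by rewrite divr_gt0.
have [k kP] := cantor_dist_small e20; exists k => S TS; apply: eB.
rewrite ballEmdist /=; apply: (@le_lt_trans _ _ (e / 2)).
  by apply: aut_dist_le => y; apply/ltW/kP/TS.
by rewrite ltr_pdivrMr// ltr_pMr// ltr1n.
Qed.

Lemma dense_minimal_aut (D : set (minimal_aut R)) T k : dense D ->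
  exists2 S, D S & forall y, agree k (F T y) (F S y).
Proof.
pose B := (ball (set_val T : cantor_aut R) (2 ^- k))°.
move=> /(_ (set_val @^-1` B))[||S [BS DS]].
- exists T; apply: nbhsx_ballx; by rewrite invr_gt0 exprn_gt0.
- by exists B => //; exact: open_interior.
exists S => // y.
have := interior_subset BS; rewrite ballEmdist /= => TS.
suff /agree_cantor_dist : cantor_dist R (F T y) (F S y) < 2 ^- k by exact: agree_le.
exact: le_lt_trans (aut_dist_ge _ _ _) TS.
Qed.

End minimal_aut_topology.

Lemma generic_minimal_aut_cyclic (R : realType) (G : set (minimal_aut R)) :
  Gdelta G -> dense G -> exists2 T, G T &
    forall n, exists L k p, cyclic_coding (aut_fun (set_val T)) n L k p.
Proof.
move=> [U oU GU] dG; pose F (T : minimal_aut R) := aut_fun (set_val T).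
(* A state is a map with the number of coordinates that later stages must preserve. Step [n] keeps
   the old ones, acquires a coding of mesh [n], and preserves enough coordinates to retain the
   coding and to stay inside the open set [U n]. *)
have step (a : nat * (minimal_aut R * nat)) : exists b : minimal_aut R * nat,
    [/\ (maxn a.1.+1 a.2.2 <= b.2)%N,
        forall y, agree a.2.2 (F a.2.1 y) (F b.1 y),
        exists L p, cyclic_coding (F b.1) a.1 L b.2 p &
        forall S, (forall y, agree b.2 (F b.1 y) (F S y)) -> U a.1 S].
  case: a => n [T k] /=; have [T1 GT1 TT1] := dense_minimal_aut T k dG.
  have [k1 k1U] : exists k1, forall S, (forall y, agree k1 (F T1 y) (F S y)) -> U n S.
    by apply: open_minimal_aut => //; move: GT1; rewrite GU; exact.
  (* [n] serves the mesh, [k] closeness to [T], and [k1] membership in [U n]. *)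
  pose N := maxn n (maxn k k1).
  have [T2 [_ T12 [L [k2 [p [pL pk pn pt]]]]]] := rank1_approximation T1 N.
  exists (T2, maxn n.+1 (maxn k2 (maxn k k1))); split => /=.
  - by rewrite /N; lia.
  - move=> y; apply: agree_trans (TT1 y) _.
    by apply: agree_le (T12 y); rewrite /N; lia.
  - exists L, p; split=> // y y'.
      by move=> yy'; apply: pk; apply: agree_le yy'; lia.
    by move=> /pn; apply: agree_le; rewrite /N; lia.
  - move=> S T2S; apply: k1U => y.
    apply: (agree_trans (y := F T2 y)).
      by apply: agree_le (T12 y); rewrite /N; lia.
    by apply: agree_le (T2S y); lia.
have [f fP] := choice step; have [T0 _] := minimal_aut_inhabited R.
pose fix st n := if n is m.+1 then f (m, st m) else (T0, 0%N).
pose T n := F (st n).1; pose k n := (st n).2.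
have kS n : (maxn n.+1 (k n) <= k n.+1)%N by have [] := fP (n, st n).
have TS n y : agree (k n) (T n y) (T n.+1 y).
  by have [_ fa _ _] := fP (n, st n); exact: fa.
have Tle n m y : (n <= m)%N -> (k n <= k m)%N /\ agree (k n) (T n y) (T m y).
  move=> /subnKC <-; elim: (m - n)%N => [|d [IH1 IH2]].
    by rewrite addn0; split=> //; exact: agree_refl.
  rewrite addnS; split; first by have := kS (n + d)%N; lia.
  by apply: agree_trans IH2 (agree_le IH1 (TS _ _)).
(* Coordinate [i] is final from stage [i + 1] on, as [k i.+1 > i]. *)
pose t (y : cantor_space) : cantor_space := fun i => T i.+1 y i.
have Tt n y : agree (k n) (T n y) (t y).
  move=> i ik; have [ni|/ltnW ni] := leqP n i.+1; first by have [_ ->] := Tle _ _ y ni.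
  by have [_ <-//] := Tle _ _ y ni; have := kS i; lia.
have tP n : exists L k p, cyclic_coding t n L k p.
  (* The coding of stage [n + 1] reads only [k n.+1] coordinates, on which [T n.+1] and [t] agree,
     so it codes [t] as well. *)
  have [_ _ [L [p [pL pk pn pt]]] _] := fP (n, st n).
  exists L, (k n.+1), p; split=> // y.
  by rewrite -pt; apply/esym/pk; exact: (Tt n.+1 y).
have [ht mt] := cyclic_coding_odometer tP.
have [S SE] := minimal_aut_ex R ht mt.
exists S; last by rewrite SE.
rewrite GU => n _; have [_ _ _] := fP (n, st n); apply => y.
by rewrite /F SE; exact: (Tt n.+1 y).
Qed.

Theorem proposition7p1 (R : realType) :
  let A : set (minimal_aut R) :=
    [set T | conjugate_to_rank1 (aut_fun (set_val T))] in
  dense A /\ ~ generic A.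
Proof.
move=> A; split=> [W [T WT] oW|[G [GG dG GA]]].
  have [k kW] := open_minimal_aut oW WT.
  have [S [SA TS _]] := rank1_approximation T k.
  by exists S; split; [exact: kW|].
have [T GT TP] := generic_minimal_aut_cyclic GG dG.
exact: cyclic_coding_not_rank1 TP (GA _ GT).
Qed.
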